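(* Consider the $s$-stage semi-Lagrangian IMEX-RK scheme $$f^{(i)} = \tilde{\mathcal S}_{i,0}[f^n] + \Delta t\sum_{j=1}^{i-1} a_{ij}\,\mathcal S_{i,j}\Big[\tfrac1\varepsilon G_P(f^{(j)})\Big] + \Delta t\sum_{j=1}^{i}\tilde a_{ij}\,\tilde{\mathcal S}_{i,j}\Big[\tfrac1\varepsilon Q_P(f^{(j)})\Big],\quad i=1,\dots,s.$$ Adopt the convention that all quantities with non-positive subscripts are treated as zero. (1) If the scheme is of type A, then it can be written, for $i=1,\dots,s$, as $$f^{(i)}=\big(1-\bar{\tilde A}_i\tilde A_{(i-1)}^{-1}e_{(i-1)}\big)\tilde{\mathcal S}_{i,0}[f^n]+\big(\bar{\tilde A}_i\tilde A^{-1}_{(i-1)}\big)\tilde{\mathcal S}^i[F_{(i-1)}]+\frac{\Delta t}{\varepsilon}\tilde a_{ii}Q_P(f^{(i)})+\Delta t\,E^i\Big[\mathcal S^i,\tilde{\mathcal S}^i,\tfrac1\varepsilon G_P(F_{(i-1)})\Big],$$ where $E^i[\mathcal S^i,\tilde{\mathcal S}^i,G_P(F_{(i-1)})]$ is a linear combination of terms involving $\mathcal S_{i,j}$, $\tilde{\mathcal S}_{i,j}$ (and compositions of such shift operators) and $G_P(f^{(j)})$ for $1\le j\le i-1$. (2) If the scheme is of type CK and $c_i=\tilde c_i$ for all $1\le i\le s$, then it can be written, for $i=1,\dots,s$, as $$f^{(i)}=\big(1-B_i\hat e_{(i-1)}\big)\mathcal S_{i,0}[f^n]+B_i\mathcal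 S^i[\hat F_{(i-1)}]+\frac{\Delta t}{\varepsilon}\tilde{\hat a}_{(i-1)(i-1)}Q_P(f^{(i)})+\Delta t\,D_i\mathcal S^i\Big[\tfrac1\varepsilon G_P(\hat F_{(i-1)})\Big]+\Delta t\,d_i\,\mathcal S_{i,0}\Big[\tfrac1\varepsilon G_P(f^n)\Big],$$ where $$B_i=\bar{\tilde{\hat A}}_{i-1}\tilde{\hat A}^{-1}_{(i-2)},\qquad D_i=\bar{\hat A}_{i-1}-\bar{\tilde{\hat A}}_{i-1}\tilde{\hat A}^{-1}_{(i-2)}\hat A_{(i-2)},\qquad d_i=a_{i-1}-B_ia_{(i-2)} .$$
   Context: The scheme discretizes the Boltzmann equation $\partial_tf+v\,\partial_xf=\frac1\varepsilon Q(f)$ ($\varepsilon>0$ constant, $x$ one-dimensional, velocity in $\mathbb R^{d_v}$; in transport terms and shifts $v$ is the first velocity component), where $Q(f)(v)=\int_{\mathbb R^{d_v}}\int_{\mathbb S^{d_v-1}}\mathcal B(|v-v_*|,\sigma)[f(v')f(v'_* )-f(v)f(v_* )]\,d\sigma\,dv_*$ with $v'=\frac{v+v_*}2+\frac{|v-v_*|}2\sigma$, $v'_*=\frac{v+v_*}2-\frac{|v-v_*|}2\sigma$ and collision kernel $\mathcal B\ge0$. $Q_P(f)=\beta(f)(\mathcal M[f]-f)$, where $\beta(f)=\max_v\int_{\mathbb R^{d_v}}\int_{\mathbb S^{d_v-1}}\mathcal B(|v-v_*|,\sigma)f(v_* )\,d\sigma\,dv_*$ is a penalization parameter and $\mathcal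 M[f]=\frac{\rho}{(2\pi T)^{d_v/2}}\exp(-\frac{|v-u|^2}{2T})$ is the Maxwellian built from the density $\rho$, bulk velocity $u$ and temperature $T$ of $f$; $G_P(f)=Q(f)-Q_P(f)$. $\mathcal S_{i,j}[f](x,v)=f(x-(c_i-c_j)v\Delta t,v)$ and $\tilde{\mathcal S}_{i,j}[f](x,v)=f(x-(\tilde c_i-\tilde c_j)v\Delta t,v)$, with $c_0=\tilde c_0=0$. Butcher tableaux: $A=(a_{ij})$, $\tilde A=(\tilde a_{ij})\in\mathbb R^{s\times s}$ with $a_{ij}=0$ for $j\ge i$, $\tilde a_{ij}=0$ for $j>i$; $c_i=\sum_ja_{ij}$, $\tilde c_i=\sum_j\tilde a_{ij}$. Type A: $\tilde A$ is invertible. Type CK: $\tilde A=\begin{pmatrix}0&0\\ \tilde a&\tilde{\hat A}\end{pmatrix}$ with $\tilde a\in\mathbb R^{s-1}$ and $\tilde{\hat A}=(\tilde{\hat a}_{ij})\in\mathbb R^{(s-1)\times(s-1)}$ invertible, and correspondingly one writes $A=\begin{pmatrix}0&0\\ a&\hat A\end{pmatrix}$ with $a=(a_1,\dots,a_{s-1})^\top$. Notation: for a vector $w$, $w_{(k)}$ is the vector of its first $k$ entries and $\hat w$ is $w$ with its first entry deleted (so $\hat e_{(i-1)}=(1,\dots,1)^\top\in\mathbb R^{i-2}$ and $\hat F_{(i-1)}=(f^{(2)},\dots,f^{(i-1)})^\top$). For a matrix $C$, $C_{(k)}$ is its leading $k\times k$ block, $\bar C_k=(c_{k1},\dots,c_{k(k-1)})$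 is the first $k-1$ entries of its $k$-th row, and for invertible lower triangular $C$, $C^{-1}_{(k)}=(C_{(k)})^{-1}=(C^{-1})_{(k)}$. $e=(1,\dots,1)^\top\in\mathbb R^s$, $F=(f^{(1)},\dots,f^{(s)})^\top$, $F_{(i-1)}=(f^{(1)},\dots,f^{(i-1)})^\top$. For a vector of stage functions $\mathcal F=(f^{(j_1)},\dots,f^{(j_k)})^\top$, $\mathcal S^i[\mathcal F]=(\mathcal S_{i,j_1}[f^{(j_1)}],\dots,\mathcal S_{i,j_k}[f^{(j_k)}])^\top$; $\tilde{\mathcal S}^i$ is defined similarly, and $G_P$ is applied entrywise.
   Formalization: Part (2) as printed omits the term Δt(ã_{i-1} − B_i ã_{(i-2)}) S_{i,0}[Q_P(f^n)/ε] and is false if ã≠0 and Q_P(f^n)≠0; the formal version proves the formula with this term added, and the printed formula when ã=0 or Q_P(f^n)=0. *)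

(* Defs.v *)
From HB Require Import structures.
From mathcomp Require Import all_boot all_order all_algebra.
From mathcomp Require Import all_classical all_reals all_analysis.

Set Implicit Arguments.
Unset Strict Implicit.
Unset Printing Implicit Defensive.

Import Order.TTheory GRing.Theory Num.Theory.
Import numFieldNormedType.Exports.

Local Open Scope classical_set_scope.
Local Open Scope ring_scope.

(* Lebesgue measure on R^n, with R^n represented by the measurable type
   [n.-tuple R] (product sigma-algebra); it is built by recursion on n as the
   image of [lebesgue_measure \x lebesgue_n] under [cons]. *)
Section LebesgueRn.
Context {R : realType}.

Notation mR := (measurableTypeR R).

Definition tcons n (p : mR * n.-tuple mR) : n.+1.-tuple mR :=
  [tuple of p.1 :: p.2].

Lemma measurable_tcons n : measurable_fun setT (@tcons n).
Proof.
exact: (measurable_cons (@measurable_fst _ _ mR (n.-tuple mR))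
                        (@measurable_snd _ _ mR (n.-tuple mR))).
Qed.

Let prod_sigma_finite d1 d2 (T1 : measurableType d1) (T2 : measurableType d2)
    (m1 : {sigma_finite_measure set T1 -> \bar R})
    (m2 : {sigma_finite_measure set T2 -> \bar R}) :
  sigma_finite setT (m1 \x m2)%E.
Proof.
have /sigma_finiteP[F [TF ndF Foo]] := sigma_finiteT m1.
have /sigma_finiteP[G [TG ndG Goo]] := sigma_finiteT m2.
exists (fun n => F n `*` G n).
  rewrite -setXTT TF TG predeqE => -[x y]; split.
    move=> [/= [n _ Fnx] [k _ Gky]]; exists (maxn n k) => //; split.
    - by move: x Fnx; exact/subsetPset/ndF/leq_maxl.
    - by move: y Gky; exact/subsetPset/ndG/leq_maxr.
  by move=> [n _ []/= ? ?]; split; exists n.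
move=> k; have [? ?] := Foo k; have [? ?] := Goo k.
split; first exact: measurableX.
by rewrite product_measure1E// lte_mul_pinfty// ge0_fin_numE.
Qed.

Section Step.
Variables (n : nat)
  (mu : {sigma_finite_measure set (n.-tuple mR) -> \bar R}).

Definition leb_step : set (n.+1.-tuple mR) -> \bar R :=
  pushforward (lebesgue_measure \x mu)%E (@tcons n).

Let leb_step0 : leb_step set0 = 0%E.
Proof. by rewrite /leb_step /pushforward preimage_set0 measure0. Qed.

Let leb_step_ge0 A : (0 <= leb_step A)%E.
Proof. by rewrite /leb_step /pushforward measure_ge0. Qed.

Let leb_step_sigma_additive : semi_sigma_additive leb_step.
Proof.
move=> F mF tF mUF; rewrite /leb_step /pushforward preimage_bigcup.
apply: measure_semi_sigma_additive.
- by move=> k; rewrite -[_ @^-1` _]setTI; exact: measurable_tcons.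
- apply/trivIsetP => /= i j _ _ ij; rewrite -preimage_setI.
  by move/trivIsetP : tF => -> //; rewrite preimage_set0.
- by rewrite -preimage_bigcup -[_ @^-1` _]setTI; exact: measurable_tcons.
Qed.

HB.instance Definition _ := isMeasure.Build _ _ _ leb_step
  leb_step0 leb_step_ge0 leb_step_sigma_additive.

Let leb_step_sigma_finite : sigma_finite setT leb_step.
Proof.
have [F UF mF] := prod_sigma_finite lebesgue_measure mu.
pose h (t : n.+1.-tuple mR) := (thead t, [tuple of behead t]).
have mh : measurable_fun setT h.
  apply: measurable_fun_pair => //=.
    exact: measurable_tnth.
  exact: measurable_behead.
have hK : cancel (@tcons n) h.
  move=> [x t]; rewrite /h /tcons /=; congr pair.
  exact/val_inj.
exists (fun k => h @^-1` F k).
  by rewrite -preimage_bigcup -UF preimage_setT.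
move=> k; have [mFk Fk] := mF k; split.
  by rewrite -[_ @^-1` _]setTI; exact: mh.
rewrite /= /leb_step /pushforward -comp_preimage.
by rewrite (_ : h \o _ = id) //; apply/funext => p; exact: hK.
Qed.

HB.instance Definition _ := Measure_isSigmaFinite.Build _ _ _ leb_step
  leb_step_sigma_finite.

End Step.

Fixpoint lebesgue_n (n : nat) :
    {sigma_finite_measure set (n.-tuple mR) -> \bar R} :=
  if n is m.+1 return {sigma_finite_measure set (n.-tuple mR) -> \bar R}
  then leb_step (lebesgue_n m) else dirac ([tuple] : 0.-tuple mR).

End LebesgueRn.

Section Boltzmann.
Context {R : realType}.

(* The canonical norm of ['rV[R]_n] is the sup norm, hence this definition. *)
Definition enorm n (v : 'rV[R]_n) : R := Num.sqrt (\sum_(k < n) v 0 k ^+ 2).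

Definition vec_of n (t : n.-tuple R) : 'rV[R]_n := \row_k tnth t k.

Definition int_Rn n (g : 'rV[R]_n -> R) : R :=
  Rintegral (@lebesgue_n R n) setT (fun t => g (vec_of t)).

(* Integral over the unit sphere S^(n-1) for the surface measure, defined as
   usual from the Lebesgue measure by polar coordinates:
   sigma(A) = n * |{r w ; 0 < r <= 1, w in A}|.
   For n = 1 this is the counting measure on {-1, 1}. *)
Definition int_sphere n (g : 'rV[R]_n -> R) : R :=
  n%:R * Rintegral (@lebesgue_n R n) [set t | 0 < enorm (vec_of t) <= 1]
           (fun t => g ((enorm (vec_of t))^-1 *: vec_of t)).

Section Collision.
Variables (n : nat) (B : R -> 'rV[R]_n -> R).
Implicit Types f : 'rV[R]_n -> R.

Definition post_v (v vs sg : 'rV[R]_n) : 'rV[R]_n :=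
  2^-1 *: (v + vs) + (enorm (v - vs) / 2) *: sg.
Definition post_vs (v vs sg : 'rV[R]_n) : 'rV[R]_n :=
  2^-1 *: (v + vs) - (enorm (v - vs) / 2) *: sg.

Definition Qcoll f (v : 'rV[R]_n) : R :=
  int_Rn (fun vs => int_sphere (fun sg =>
    B (enorm (v - vs)) sg *
      (f (post_v v vs sg) * f (post_vs v vs sg) - f v * f vs))).

Definition density f : R := int_Rn f.
Definition bulk_velocity f : 'rV[R]_n :=
  (density f)^-1 *: \row_k int_Rn (fun v => v 0 k * f v).
Definition temperature f : R :=
  (n%:R * density f)^-1 *
    int_Rn (fun v => enorm (v - bulk_velocity f) ^+ 2 * f v).

Definition Maxwellian f (v : 'rV[R]_n) : R :=
  density f / (2 * pi * temperature f) `^ (n%:R / 2) *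
    expR (- (enorm (v - bulk_velocity f) ^+ 2 / (2 * temperature f))).

(* The maximum over v is the real supremum. *)
Definition penalty f : R :=
  sup (range (fun v : 'rV[R]_n =>
    int_Rn (fun vs => int_sphere (fun sg => B (enorm (v - vs)) sg * f vs)))).

Definition Q_P f (v : 'rV[R]_n) : R := penalty f * (Maxwellian f v - f v).
Definition G_P f (v : 'rV[R]_n) : R := Qcoll f v - Q_P f v.

End Collision.
End Boltzmann.

(* Tableau entries are accessed with the usual 1-based indices; an out-of-range
   entry, in particular one with a zero index, is 0.  Thus the first entry of a
   row is [coef C i 1], and [node C 0 = 0]. *)
Section Tableau.
Context {R : realType}.

Definition coef m n (C : 'M[R]_(m, n)) (i j : nat) : R :=
  if (0 < i)%N && (0 < j)%N then
    if (insub i.-1 : option 'I_m, insub j.-1 : option 'I_n)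
       is (Some p, Some q) then C p q else 0
  else 0.

Definition node s (C : 'M[R]_s) (i : nat) : R := \sum_(1 <= j < s.+1) coef C i j.

(* [lead C k] is C_(k); [bar C k] is the vector of the first k - 1 entries of
   the k-th row of C; [lead_col w k] is w_(k). *)
Definition lead s (C : 'M[R]_s) (k : nat) : 'M[R]_k :=
  \matrix_(p, q) coef C p.+1 q.+1.
Definition bar s (C : 'M[R]_s) (k : nat) : 'rV[R]_k.-1 :=
  \row_q coef C k q.+1.
Definition ones (k : nat) : 'cV[R]_k := const_mx 1.
Definition lead_col s (w : 'cV[R]_s) (k : nat) : 'cV[R]_k :=
  \col_p coef w p.+1 1.

(* C^ and w in the block form of a tableau whose first row is 0:
   rows 2, ..., s are (w  C^). *)
Definition hat_mx s (C : 'M[R]_s) : 'M[R]_s.-1 :=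
  \matrix_(p, q) coef C p.+2 q.+2.
Definition hat_col s (C : 'M[R]_s) : 'cV[R]_s.-1 := \col_p coef C p.+2 1.

Definition explicit_tableau s (A : 'M[R]_s) : Prop :=
  forall p q : 'I_s, (p <= q)%N -> A p q = 0.
Definition diag_implicit_tableau s (At : 'M[R]_s) : Prop :=
  forall p q : 'I_s, (p < q)%N -> At p q = 0.

Definition type_A s (At : 'M[R]_s) : Prop := At \in unitmx.
Definition type_CK s (At : 'M[R]_s) : Prop :=
  (forall j, coef At 1 j = 0) /\ hat_mx At \in unitmx.

Section CKCoefficients.
Variables (s : nat) (A At : 'M[R]_s).

Definition B_CK (i : nat) : 'rV[R]_i.-2 :=
  bar (hat_mx At) i.-1 *m invmx (lead (hat_mx At) i.-2).
Definition D_CK (i : nat) : 'rV[R]_i.-2 :=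
  bar (hat_mx A) i.-1 - B_CK i *m lead (hat_mx A) i.-2.
Definition d_CK (i : nat) : R :=
  coef (hat_col A) i.-1 1 - (B_CK i *m lead_col (hat_col A) i.-2) 0 0.
(* The analogue of [d_CK] for the first column of the implicit tableau: it is
   the weight of Q_P(f^(1)) = Q_P(f^n) left over when the Q_P(f^(j)), j >= 2,
   are eliminated, and it is zero for every i iff that column is zero. *)
Definition dt_CK (i : nat) : R :=
  coef (hat_col At) i.-1 1 - (B_CK i *m lead_col (hat_col At) i.-2) 0 0.

End CKCoefficients.
End Tableau.

Section Scheme.
Context {R : realType}.
Variable d : nat.
(* Phase-space functions f(x, v), with d_v = d.+1. *)
Local Notation phase := (R -> 'rV[R]_d.+1 -> R).

Definition sl_shift s (C : 'M[R]_s) (dt : R) (i j : nat) (f : phase) : phase :=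
  fun x v => f (x - (node C i - node C j) * v 0 0 * dt) v.

(* w . S^i[(f^(m), ..., f^(m+k-1))] *)
Definition row_shift s (C : 'M[R]_s) (dt : R) (i : nat) k (w : 'rV[R]_k)
    (m : nat) (F : nat -> phase) : phase :=
  fun x v => \sum_(q < k) w 0 q * sl_shift C dt i (m + q) (F (m + q)%N) x v.

(* A term of a formal linear combination: a real coefficient, a word of shift
   symbols (true, i, j) = S~_{i,j}, (false, i, j) = S_{i,j} to be composed, and
   the index of the function to which it applies. *)
Definition shift_term := (R * seq (bool * nat * nat) * nat)%type.

(* Admissible terms of E^i. *)
Definition admissible (i : nat) (t : shift_term) : bool :=
  (0 < t.2 < i)%N && all (fun w => (w.1.2 <= i)%N && (w.2 <= i)%N) t.1.2.

Definition eval_word s (A At : 'M[R]_s) (dt : R) (w : seq (bool * nat * nat))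
    (f : phase) : phase :=
  foldr (fun a g => sl_shift (if a.1.1 then At else A) dt a.1.2 a.2 g) f w.

Definition eval_comb s (A At : 'M[R]_s) (dt : R) (E : seq shift_term)
    (F : nat -> phase) : phase :=
  fun x v => \sum_(t <- E) t.1.1 * eval_word A At dt t.1.2 (F t.2) x v.

Section Stages.
Variables (B : R -> 'rV[R]_d.+1 -> R) (s : nat) (A At : 'M[R]_s).
Variables (eps dt : R) (fn : phase) (F : nat -> phase).

(* [epsQ f] and [epsG f] are Q_P(f) / eps and G_P(f) / eps; the collision
   operators act on the velocity variable only. *)
Definition epsQ (f : phase) : phase := fun x v => eps^-1 * Q_P B (f x) v.
Definition epsG (f : phase) : phase := fun x v => eps^-1 * G_P B (f x) v.

Local Notation S := (sl_shift A dt).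
Local Notation St := (sl_shift At dt).

Definition imex_scheme (i : nat) : Prop := forall x v,
  F i x v = St i 0 fn x v
    + dt * \sum_(1 <= j < i) coef A i j * S i j (epsG (F j)) x v
    + dt * \sum_(1 <= j < i.+1) coef At i j * St i j (epsQ (F j)) x v.

Definition type_A_form (E : seq shift_term) (i : nat) : Prop := forall x v,
  let w := bar At i *m invmx (lead At i.-1) in
  F i x v = (1 - (w *m ones _) 0 0) * St i 0 fn x v
    + row_shift At dt i w 1 F x v
    + dt / eps * coef At i i * Q_P B (F i x) v
    + dt * eval_comb A At dt E (fun j => epsG (F j)) x v.

Definition type_CK_rhs (i : nat) : phase := fun x v =>
  (1 - (B_CK At i *m ones _) 0 0) * S i 0 fn x v
    + row_shift A dt i (B_CK At i) 2 F x v
    + dt / eps * coef (hat_mx At) i.-1 i.-1 * Q_P B (F i x) v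
    + dt * row_shift A dt i (D_CK A At i) 2 (fun j => epsG (F j)) x v
    + dt * d_CK A At i * S i 0 (epsG fn) x v.

End Stages.
End Scheme.

(* Main.v *)
Require Import Defs.
From mathcomp Require Import all_boot all_order all_algebra.
From mathcomp Require Import all_classical all_reals all_analysis.
From mathcomp Require Import ring.

Set Implicit Arguments.
Unset Strict Implicit.

Import Order.TTheory GRing.Theory Num.Theory.
Local Open Scope ring_scope.

(* Along a characteristic (fixed v, evaluation at x - (c~_i - c~_k) v dt) the
   composed shifts telescope, and each stage of the scheme is a scalar identity
   in which the stiff terms Q_P(f^(j)), j <= i, enter through a lower triangular
   tableau.  Stages 1, ..., i-1 are solved for their stiff terms by inverting the
   leading block, and the result is substituted in stage i.  In the type CK
   case the first stage is explicit and gives f^(1) = f^n, so the elimination is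
   applied to the tableau without its first row and column. *)

(** * Entries of tableaux and elimination in a lower triangular tableau *)

Lemma big_ord_truncate (V : nmodType) n k (f : nat -> V) :
    (k <= n)%N -> (forall j, (k <= j)%N -> f j = 0) ->
  \sum_(j < n) f j = \sum_(0 <= j < k) f j.
Proof.
move=> kn f0; rewrite -(big_mkord xpredT f) (big_cat_nat (n := k)) //=.
rewrite big_nat [X in _ + X]big_nat [X in _ + X]big1 ?addr0 -?big_nat //.
by move=> j /andP[kj _]; exact: f0.
Qed.

Section Tableau.
Context {R : realType}.

Lemma coefE m n (C : 'M[R]_(m, n)) (p : 'I_m) (q : 'I_n) :
  coef C p.+1 q.+1 = C p q.
Proof. by rewrite /coef /= !valK. Qed.

Lemma coef_oob_row m n (C : 'M[R]_(m, n)) i j : (m < i)%N -> coef C i j = 0.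
Proof.
case: i => [//|i] mi; rewrite /coef /=; case: ifP => // _.
by rewrite insubF //; apply/negbTE; rewrite -leqNgt.
Qed.

Lemma coef_oob_col m n (C : 'M[R]_(m, n)) i j : (n < j)%N -> coef C i j = 0.
Proof.
case: j => [//|j] nj; rewrite /coef /= andbT; case: ifP => // _.
rewrite (@insubF _ (fun k => k < n)%N) //; last by apply/negbTE; rewrite -leqNgt.
by case: insub.
Qed.

(** Outside the block both sides are zero by the default value of [coef], so the index shift by one
    holds for all i and j. *)
Lemma coef_hat_mx s (C : 'M[R]_s) i j :
  coef (hat_mx C) i.+1 j.+1 = coef C i.+2 j.+2.
Proof.
have [is_|si] := ltnP i s.-1; last first.
  by rewrite !coef_oob_row // ltnS; case: s C si.
have [js|sj] := ltnP j s.-1; last first.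
  by rewrite !coef_oob_col // ltnS; case: s C is_ sj.
by rewrite (coefE _ (Ordinal is_) (Ordinal js)) mxE.
Qed.

Lemma coef_hat_col s (C : 'M[R]_s) i : coef (hat_col C) i.+1 1 = coef C i.+2 1.
Proof.
have [is_|si] := ltnP i s.-1; last first.
  by rewrite !coef_oob_row // ltnS; case: s C si.
by rewrite (coefE _ (Ordinal is_) ord0) mxE.
Qed.

Lemma coef_diag_implicit s (C : 'M[R]_s) i j :
  diag_implicit_tableau C -> (i < j)%N -> coef C i j = 0.
Proof.
move=> hC; case: i j => [|i] [|j] // ij.
have [js|sj] := ltnP j s; last by rewrite coef_oob_col.
have is_ : (i < s)%N := ltn_trans (ij : (i < j)%N) js.
by rewrite (coefE C (Ordinal is_) (Ordinal js)) hC.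
Qed.

Lemma coef_explicit s (C : 'M[R]_s) i j :
  explicit_tableau C -> (i <= j)%N -> coef C i j = 0.
Proof.
move=> hC; case: i j => [|i] [|j] // ij.
have [js|sj] := ltnP j s; last by rewrite coef_oob_col.
have is_ : (i < s)%N := leq_ltn_trans (ij : (i <= j)%N) js.
by rewrite (coefE C (Ordinal is_) (Ordinal js)) hC.
Qed.

Lemma hat_mx_diag_implicit s (C : 'M[R]_s) :
  diag_implicit_tableau C -> diag_implicit_tableau (hat_mx C).
Proof. by move=> hC p q pq; rewrite mxE coef_diag_implicit. Qed.

(** The determinant of a triangular matrix is the product of its diagonal, and the diagonal of the
    leading block is part of that of [C]. *)
Lemma lead_unitmx s (C : 'M[R]_s) k :
  diag_implicit_tableau C -> C \in unitmx -> (k <= s)%N -> lead C k \in unitmx.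
Proof.
move=> hC + ks; rewrite !unitmxE !unitfE det_trig; last exact/is_trig_mxP.
rewrite det_trig; last first.
  by apply/is_trig_mxP => p q pq; rewrite mxE coef_diag_implicit.
move=> /prodf_neq0 C0; apply/prodf_neq0 => p _.
by rewrite mxE (coefE C (widen_ord ks p) (widen_ord ks p)) C0.
Qed.

Lemma node_explicit1 s (C : 'M[R]_s) : explicit_tableau C -> node C 1 = 0.
Proof.
by move=> hC; rewrite /node big_nat big1 // => j /andP[j1 _]; exact: coef_explicit.
Qed.

(** Since [w] times the leading block is the row [bar C i.+1], weighting the first i rows by [w]
    reproduces row i+1 up to its diagonal. The inner sums may stop at the diagonal by
    triangularity. *)
Lemma bar_solve s (C : 'M[R]_s) i (q : nat -> R) :
    diag_implicit_tableau C -> C \in unitmx -> (i < s)%N ->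
  let w := bar C i.+1 *m invmx (lead C i) in
  \sum_(k < i) w 0 k * (\sum_(1 <= j < k.+2) coef C k.+1 j * q j) =
  \sum_(1 <= j < i.+1) coef C i.+1 j * q j.
Proof.
move=> hC uC is_ w.
have wL : w *m lead C i = bar C i.+1.
  by rewrite mulmxKV // lead_unitmx // ltnW.
rewrite big_add1 big_mkord /=.
transitivity (\sum_(k < i) \sum_(j < i) w 0 k * (lead C i k j * q j.+1)).
  apply: eq_bigr => k _; rewrite -mulr_sumr; congr (_ * _).
  rewrite big_add1 /= -(big_ord_truncate (n := i)) //; last first.
    by move=> j kj; rewrite coef_diag_implicit ?mul0r.
  by apply: eq_bigr => j _; rewrite mxE.
rewrite exchange_big /=; apply: eq_bigr => j _.
have /(congr1 (fun M : 'rV_i => M 0 j)) := wL; rewrite !mxE => <-.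
by rewrite mulr_suml; apply: eq_bigr => k _; rewrite mulrA.
Qed.

(** Here [q] stands for the stiff terms, [y] for the stage values and [h] for all the rest. The sums
    of stiff terms of the earlier stages are traded for [y - h]; only the diagonal term stays
    implicit. Type A uses it with [At], type CK with [hat_mx At]. *)
Lemma stage_elim s (C : 'M[R]_s) (dt : R) i (h q y : nat -> R) :
    diag_implicit_tableau C -> C \in unitmx -> (i < s)%N ->
    (forall k, (0 < k <= i)%N ->
       y k = h k + dt * \sum_(1 <= j < k.+1) coef C k j * q j) ->
  let w := bar C i.+1 *m invmx (lead C i) in
  h i.+1 + dt * \sum_(1 <= j < i.+2) coef C i.+1 j * q j =
  h i.+1 - \sum_(k < i) w 0 k * h k.+1 + \sum_(k < i) w 0 k * y k.+1
    + dt * coef C i.+1 i.+1 * q i.+1.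
Proof.
move=> hC uC is_ hy w.
rewrite big_nat_recr //= -(bar_solve q hC uC is_) -/w.
under [X in _ = _ + X + _]eq_bigr => k _ do rewrite hy ?ltn_ord // mulrDr.
rewrite big_split /=.
under [X in _ = _ + (_ + X) + _]eq_bigr => k _ do rewrite mulrCA.
by rewrite -mulr_sumr; ring.
Qed.

End Tableau.

(** * Shifts along characteristics *)

Section Shifts.
Context {R : realType} (d s : nat).
Implicit Types (f : R -> 'rV[R]_d.+1 -> R) (C : 'M[R]_s).

(** The displacements add up, (c_i - c_k) + (c_k - c_j) = c_i - c_j, because both shifts come from
    the same tableau. *)
Lemma sl_shift_trans C dt i k j f x (v : 'rV[R]_d.+1) :
  sl_shift C dt k j f (x - (node C i - node C k) * v 0 0 * dt) v =
  sl_shift C dt i j f x v.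
Proof. by rewrite /sl_shift; congr (f _ v); ring. Qed.

Lemma sl_shift_node C dt i j f x v :
  node C i = node C j -> sl_shift C dt i j f x v = f x v.
Proof. by move=> ij; rewrite /sl_shift ij; congr (f _ v); ring. Qed.

Lemma eq_node_shift C C' dt i j f x v :
  node C i = node C' i -> node C j = node C' j ->
  sl_shift C dt i j f x v = sl_shift C' dt i j f x v.
Proof. by rewrite /sl_shift => -> ->. Qed.

End Shifts.

(** Each stagewise equivalence presupposes the scheme at the earlier stages. In the converse
    direction these are recovered one by one, by strong induction. *)
Lemma forall_range_iff (s : nat) (P Q : nat -> Prop) :
    (forall i, (1 <= i <= s)%N ->
       (forall k, (1 <= k < i)%N -> P k) -> P i <-> Q i) ->
  (forall i, (1 <= i <= s)%N -> P i) <-> (forall i, (1 <= i <= s)%N -> Q i).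
Proof.
move=> PQ; split=> [hP i iS|hQ].
  apply: (proj1 (PQ i iS _)); last exact: hP.
  move=> k /andP[k1 ki]; apply: hP.
  by case/andP: iS => _; rewrite k1; apply/leq_trans/ltnW.
elim/ltn_ind=> i IH iS; apply: (proj2 (PQ i iS _)); last exact: hQ.
move=> k /andP[k1 ki]; apply: IH => //.
by case/andP: iS => _; rewrite k1; apply/leq_trans/ltnW.
Qed.

(** * Type A *)

Section TypeA.
Context {R : realType} (s : nat) (A At : 'M[R]_s).

(** The first list is the explicit part of stage i. The second subtracts the explicit parts of the
    earlier stages k+1, weighted by [w] and carried along by S~_{i,k+1}; these words mix both
    tableaux and so do not telescope. *)
Definition type_A_comb (i : nat) : seq (shift_term (R := R)) :=
  [seq (coef A i j, [:: (false, i, j)], j) | j <- index_iota 1 i] ++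
  [seq (- ((bar At i *m invmx (lead At i.-1)) 0 k * coef A k.+1 j),
        [:: (true, i, k.+1); (false, k.+1, j)], j)
     | k <- index_enum 'I_i.-1, j <- index_iota 1 k.+1].

Lemma type_A_comb_admissible i : all (admissible i) (type_A_comb i).
Proof.
rewrite all_cat; apply/andP; split; apply/allP => t.
  move=> /mapP[j]; rewrite mem_index_iota => /andP[j1 ji] ->.
  by rewrite /admissible /= j1 ji leqnn ltnW.
move=> /allpairsPdep[k [j [_]]]; rewrite mem_index_iota => /andP[j1 jk] ->.
have ki : (k.+1 < i)%N by case: i k jk => [[]//|i] k _ /=; rewrite ltnS.
have ji : (j < i)%N := ltn_trans jk ki.
by rewrite /admissible /= j1 ji leqnn !(ltnW ki) ltnW.
Qed.

Lemma eval_type_A_comb d (dt : R) i (G : nat -> R -> 'rV[R]_d.+1 -> R) x v :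
  eval_comb A At dt (type_A_comb i) G x v =
  \sum_(1 <= j < i) coef A i j * sl_shift A dt i j (G j) x v
  - \sum_(k < i.-1) (bar At i *m invmx (lead At i.-1)) 0 k *
      \sum_(1 <= j < k.+1) coef A k.+1 j *
        sl_shift At dt i k.+1 (sl_shift A dt k.+1 j (G j)) x v.
Proof.
rewrite /eval_comb big_cat big_map big_allpairs_dep /=; congr (_ + _).
rewrite -sumrN; apply: eq_bigr => k _.
rewrite mulr_sumr -sumrN; apply: eq_bigr => j _.
by rewrite mulNr mulrA.
Qed.

Lemma type_A_stage d (B : R -> 'rV[R]_d.+1 -> R) (eps dt : R)
    (fn : R -> 'rV[R]_d.+1 -> R) (F : nat -> R -> 'rV[R]_d.+1 -> R) i :
    diag_implicit_tableau At -> type_A At -> (1 <= i <= s)%N ->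
    (forall k, (1 <= k < i)%N -> imex_scheme B A At eps dt fn F k) ->
  imex_scheme B A At eps dt fn F i <->
  type_A_form B A At eps dt fn F (type_A_comb i) i.
Proof.
case: i => [//|i] hAt uAt is_ IH.
(* The two right-hand sides agree as soon as the earlier stages hold, which gives both directions of
   the equivalence. *)
suff E x v : sl_shift At dt i.+1 0 fn x v
    + dt * \sum_(1 <= j < i.+1)
        coef A i.+1 j * sl_shift A dt i.+1 j (epsG B eps (F j)) x v
    + dt * \sum_(1 <= j < i.+2)
        coef At i.+1 j * sl_shift At dt i.+1 j (epsQ B eps (F j)) x v =
  let w := bar At i.+1 *m invmx (lead At i) in
  (1 - (w *m ones _) 0 0) * sl_shift At dt i.+1 0 fn x v
    + row_shift At dt i.+1 w 1 F x v
    + dt / eps * coef At i.+1 i.+1 * Q_P B (F i.+1 x) v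
    + dt * eval_comb A At dt (type_A_comb i.+1)
             (fun j => epsG B eps (F j)) x v.
  by split=> H x v; rewrite H E.
pose w : 'rV[R]_i := bar At i.+1 *m invmx (lead At i); rewrite -/w /=.
pose f0 := sl_shift At dt i.+1 0 fn x v.
(* The explicit part of stage k, read at the foot of the characteristic of S~_{i+1,k}. By
   telescoping, the f^n term there is the same [f0] for every k. *)
pose g k := \sum_(1 <= j < k) coef A k j *
  sl_shift At dt i.+1 k (sl_shift A dt k j (epsG B eps (F j))) x v.
have gi : g i.+1 = \sum_(1 <= j < i.+1)
    coef A i.+1 j * sl_shift A dt i.+1 j (epsG B eps (F j)) x v.
  by apply: eq_bigr => j _; rewrite [sl_shift At _ _ _ _ _ _]sl_shift_node.
rewrite -gi.
rewrite (@stage_elim _ _ At dt i (fun k => f0 + dt * g k)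
  (fun j => sl_shift At dt i.+1 j (epsQ B eps (F j)) x v)
  (fun k => sl_shift At dt i.+1 k (F k) x v)) //; last first.
  move=> k ki; rewrite [LHS](IH k ki); congr (_ + _ + dt * _).
  - exact: sl_shift_trans.
  - by apply: eq_bigr => j _; rewrite sl_shift_trans.
rewrite eval_type_A_comb -gi -/w sl_shift_node // /epsQ /row_shift -/f0.
have -> : (w *m ones i) 0 0 = \sum_(k < i) w 0 k.
  by rewrite mxE; apply: eq_bigr => k _; rewrite [ones _ _ _]mxE mulr1.
under eq_bigr => k _ do rewrite mulrDr mulrCA.
rewrite big_split /= -mulr_sumr -mulr_suml.
have -> : \sum_(k < i) w 0 k * sl_shift At dt i.+1 (1 + k) (F (1 + k)%N) x v =
          \sum_(k < i) w 0 k * sl_shift At dt i.+1 k.+1 (F k.+1) x v by [].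
by rewrite /g; ring.
Qed.

End TypeA.

(** * Type CK with equal nodes *)

Section TypeCK.
Context {R : realType} (s : nat) (A At : 'M[R]_s).
Hypotheses (hA : explicit_tableau A) (hAt : diag_implicit_tableau At).
Hypotheses (hCK : type_CK At).
Hypothesis (hc : forall i, (1 <= i <= s)%N -> node A i = node At i).

Lemma dt_CK_hat_col0 i : hat_col At = 0 -> dt_CK At i = 0.
Proof.
have c0 m n k l : coef (0 : 'M[R]_(m, n)) k l = 0.
  by rewrite /coef; case: ifP => // _; case: insub => // p; case: insub => // q;
    rewrite mxE.
move=> h0; rewrite /dt_CK h0 c0.
rewrite (_ : lead_col 0 _ = 0) ?mulmx0 ?mxE ?subr0 //.
by apply/matrixP => p q; rewrite mxE c0 mxE.
Qed.

(** The first rows of both tableaux contribute nothing and c~_1 = c_1 = 0, so stage 1 has neither a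
    collision term nor a shift. *)
Lemma type_CK_stage1 d (B : R -> 'rV[R]_d.+1 -> R) (eps dt : R)
    (fn : R -> 'rV[R]_d.+1 -> R) (F : nat -> R -> 'rV[R]_d.+1 -> R) :
  (0 < s)%N -> imex_scheme B A At eps dt fn F 1 <-> F 1%N = fn.
Proof.
move=> s0; have n1 : node At 1 = node At 0.
  rewrite -hc // node_explicit1 // /node big_nat big1 // => j _.
have E x v : sl_shift At dt 1 0 fn x v
    + dt * \sum_(1 <= j < 1) coef A 1 j * sl_shift A dt 1 j (epsG B eps (F j)) x v
    + dt * \sum_(1 <= j < 2)
        coef At 1 j * sl_shift At dt 1 j (epsQ B eps (F j)) x v = fn x v.
  by rewrite big_geq // big_nat1 hCK.1 mul0r !mulr0 !addr0 sl_shift_node.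
split=> [H|H x v]; last by rewrite E H.
by apply/funext => x; apply/funext => v; rewrite H E.
Qed.

(** At i = 1 the row vectors are empty and the coefficients of index 0 are zero by default, so only
    f^n survives. *)
Lemma type_CK_rhs1 d (B : R -> 'rV[R]_d.+1 -> R) (eps dt : R)
    (fn : R -> 'rV[R]_d.+1 -> R) (F : nat -> R -> 'rV[R]_d.+1 -> R) x v :
  type_CK_rhs B A At eps dt fn F 1 x v
    + dt * dt_CK At 1 * sl_shift A dt 1 0 (epsQ B eps fn) x v = fn x v.
Proof.
have z (C : 'M[R]_s) : coef (hat_col C) 0 1 = 0 by [].
rewrite /type_CK_rhs /row_shift !big_ord0 /dt_CK /d_CK !mxE !big_ord0 !z.
rewrite [coef _ _ _](_ : _ = 0) // [sl_shift _ _ _ _ fn _ _]sl_shift_node; last first.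
  by rewrite node_explicit1 // /node big_nat big1 // => j _.
by ring.
Qed.

(** Stage i is row i-1 of the hatted tableau. The first column of [At] lies outside the inverted
    block, so its terms survive as Q_P(f^n) with weight [dt_CK]. *)
Lemma type_CK_stage d (B : R -> 'rV[R]_d.+1 -> R) (eps dt : R)
    (fn : R -> 'rV[R]_d.+1 -> R) (F : nat -> R -> 'rV[R]_d.+1 -> R) i :
    (1 <= i <= s)%N ->
    (forall k, (1 <= k < i)%N -> imex_scheme B A At eps dt fn F k) ->
  imex_scheme B A At eps dt fn F i <->
  (forall x v, F i x v = type_CK_rhs B A At eps dt fn F i x v
     + dt * dt_CK At i * sl_shift A dt i 0 (epsQ B eps fn) x v).
Proof.
case: i => [//|[|i]] is_ IH.
  rewrite type_CK_stage1; last by case/andP: is_.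
  split=> [-> x v|H]; first by rewrite type_CK_rhs1.
  by apply/funext => x; apply/funext => v; rewrite H type_CK_rhs1.
have s0 : (0 < s)%N by case/andP: is_ => _; apply: leq_trans.
have F1 : F 1%N = fn by apply/(type_CK_stage1 B eps dt) => //; exact: IH.
have n0 (C : 'M[R]_s) : node C 0 = 0 by rewrite /node big_nat big1.
have nS k : (k <= i.+2)%N -> node A k = node At k.
  case: k => [|k] ki; first by rewrite !n0.
  by apply: hc; case/andP: is_ => _; apply: leq_trans.
have n10 : node A 1 = node A 0 by rewrite node_explicit1 // n0.
suff E x v : sl_shift At dt i.+2 0 fn x v
    + dt * \sum_(1 <= j < i.+2)
        coef A i.+2 j * sl_shift A dt i.+2 j (epsG B eps (F j)) x v
    + dt * \sum_(1 <= j < i.+3)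
        coef At i.+2 j * sl_shift At dt i.+2 j (epsQ B eps (F j)) x v =
  type_CK_rhs B A At eps dt fn F i.+2 x v
    + dt * dt_CK At i.+2 * sl_shift A dt i.+2 0 (epsQ B eps fn) x v.
  by split=> H x v; rewrite H E.
pose f0 := sl_shift A dt i.+2 0 fn x v.
pose g j := sl_shift A dt i.+2 j (epsG B eps (F j)) x v.
pose q j := sl_shift A dt i.+2 j (epsQ B eps (F j)) x v.
(* Everything in stage k+1 except the stiff terms of index at least 2. The explicit sum runs over
   all j < i, with zero entries from j = k-1 on, so that its range does not depend on k and sums can
   be exchanged later. *)
pose h k := f0 + dt * (coef A k.+1 1 * g 1%N)
  + dt * (\sum_(j < i) coef A k.+1 j.+2 * g j.+2)
  + dt * (coef At k.+1 1 * q 1%N).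
have stage k y : (0 < k <= i.+1)%N ->
    y = f0 + dt * \sum_(1 <= j < k.+1) coef A k.+1 j * g j
        + dt * \sum_(1 <= j < k.+2) coef At k.+1 j * q j ->
    y = h k + dt * \sum_(1 <= j < k.+1) coef (hat_mx At) k j * q j.+1.
  case: k => [//|k] ki ->.
  rewrite (big_ltn (n := k.+2)) // (big_ltn (n := k.+3)) // !(big_add1 _ _ 1) /=.
  have -> : \sum_(1 <= j < k.+1) coef A k.+2 j.+1 * g j.+1 =
            \sum_(j < i) coef A k.+2 j.+2 * g j.+2.
    rewrite big_add1 [RHS](@big_ord_truncate _ i k
      (fun j => coef A k.+2 j.+2 * g j.+2)) // => j kj.
    by rewrite coef_explicit ?mul0r.
  have -> : \sum_(1 <= j < k.+2) coef At k.+2 j.+1 * q j.+1 =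
            \sum_(1 <= j < k.+2) coef (hat_mx At) k.+1 j * q j.+1.
    by apply: eq_big_nat => -[//|j] _; rewrite coef_hat_mx.
  by rewrite /h; ring.
have uH : hat_mx At \in unitmx := hCK.2.
have dH := hat_mx_diag_implicit hAt.
(* With equal nodes, also at index 0, both kinds of shift coincide. *)
have At_A k j f y : (k <= i.+2)%N -> (j <= i.+2)%N ->
    sl_shift At dt k j f y v = sl_shift A dt k j f y v.
  by move=> ki ji; apply: eq_node_shift; rewrite nS.
rewrite At_A // -/f0.
rewrite (@eq_big_nat _ _ _ 1 i.+3 _ (fun j => coef At i.+2 j * q j));
  last by move=> j /andP[_ ji]; rewrite At_A.
(* Here [y] is the right-hand side itself, so stage i+2 is not assumed. *)
rewrite (stage i.+1 _ _ (erefl _)) ?leqnn //.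
rewrite (@stage_elim _ _ (hat_mx At) dt i h (fun j => q j.+1)
  (fun k => sl_shift A dt i.+2 k.+1 (F k.+1) x v)) //; first last.
- move=> k /andP[k0 ki]; apply: stage; first by rewrite k0 ltnW.
  have ki2 : (k.+1 <= i.+2)%N by rewrite ltnS leqW.
  rewrite [LHS]IH //; congr (_ + dt * _ + dt * _).
  + by rewrite At_A // sl_shift_trans.
  + by apply: eq_bigr => j _; rewrite sl_shift_trans.
  + apply: eq_big_nat => j /andP[_ jk].
    by rewrite At_A ?sl_shift_trans // (leq_trans _ ki2).
- by case/andP: is_ => _; case: s.
set w := _ *m _; have wE : B_CK At i.+2 = w by [].
rewrite /type_CK_rhs /row_shift wE.
have -> : (w *m ones i) 0 0 = \sum_(k < i) w 0 k.
  by rewrite mxE; apply: eq_bigr => k _; rewrite [ones _ _ _]mxE mulr1.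
have w_col (C : 'M[R]_s) :
    (w *m lead_col (hat_col C) i) 0 0 = \sum_(k < i) w 0 k * coef C k.+2 1.
  by rewrite mxE; apply: eq_bigr => k _; rewrite [lead_col _ _ _ _]mxE coef_hat_col.
rewrite /d_CK /dt_CK wE !w_col !coef_hat_col.
have DE (k : 'I_i) : D_CK A At i.+2 0 k =
    coef A i.+2 k.+2 - \sum_(l < i) w 0 l * coef A l.+2 k.+2.
  rewrite /D_CK wE mxE [bar _ _ _ _]mxE coef_hat_mx [(- (w *m _)) _ _]mxE.
  congr (_ - _).
  rewrite mxE; apply: eq_bigr => l _.
  by rewrite [lead _ _ _ _]mxE coef_hat_mx.
(* Exchanging the sums shows that [D_CK] collects the explicit terms of stage i+2 minus those of the
   eliminated stages. *)
have -> : \sum_(k < i) D_CK A At i.+2 0 k *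
      sl_shift A dt i.+2 (2 + k) (epsG B eps (F (2 + k)%N)) x v =
    \sum_(k < i) coef A i.+2 k.+2 * g k.+2 -
    \sum_(l < i) w 0 l * \sum_(k < i) coef A l.+2 k.+2 * g k.+2.
  under [X in _ = _ - X]eq_bigr => l _ do rewrite mulr_sumr.
  rewrite exchange_big -sumrB; apply: eq_bigr => k _.
  rewrite DE mulrBl mulr_suml; congr (_ - _).
  by apply: eq_bigr => l _; rewrite mulrA.
have -> : \sum_(k < i) w 0 k * h k.+1 = (\sum_(k < i) w 0 k) * f0
    + dt * g 1%N * (\sum_(k < i) w 0 k * coef A k.+2 1)
    + dt * (\sum_(l < i) w 0 l * \sum_(k < i) coef A l.+2 k.+2 * g k.+2)
    + dt * q 1%N * (\sum_(k < i) w 0 k * coef At k.+2 1).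
  rewrite mulr_suml !mulr_sumr -!big_split /=; apply: eq_bigr => k _.
  by rewrite /h; ring.
(* As c_1 = c_0 and f^(1) = f^n, the first-column terms become the f^n terms weighted by [d_CK] and
   [dt_CK]. *)
have shift1 f : sl_shift A dt i.+2 1 f x v = sl_shift A dt i.+2 0 f x v.
  by rewrite /sl_shift n10.
rewrite /h /g /q !shift1 F1 [sl_shift A dt i.+2 i.+2 _ _ _]sl_shift_node // /epsQ.
rewrite -/f0 coef_hat_mx.
ring.
Qed.

End TypeCK.

Theorem mainTheorem6 (R : realType) (s : nat) (A At : 'M[R]_s)
  (s_gt0 : (0 < s)%N)
  (hA : explicit_tableau A) (hAt : diag_implicit_tableau At) :
  (type_A At ->
   exists E : nat -> seq (shift_term (R := R)),
     (forall i, (1 <= i <= s)%N -> all (admissible i) (E i)) /\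
     forall (d : nat) (B : R -> 'rV[R]_d.+1 -> R) (eps dt : R)
       (fn : R -> 'rV[R]_d.+1 -> R) (F : nat -> R -> 'rV[R]_d.+1 -> R),
       (forall r sg, 0 <= r -> enorm sg = 1 -> 0 <= B r sg) -> 0 < eps ->
       (forall i, (1 <= i <= s)%N -> imex_scheme B A At eps dt fn F i) <->
       (forall i, (1 <= i <= s)%N -> type_A_form B A At eps dt fn F (E i) i))
  /\
  (type_CK At -> (forall i, (1 <= i <= s)%N -> node A i = node At i) ->
   forall (d : nat) (B : R -> 'rV[R]_d.+1 -> R) (eps dt : R)
     (fn : R -> 'rV[R]_d.+1 -> R) (F : nat -> R -> 'rV[R]_d.+1 -> R),
     (forall r sg, 0 <= r -> enorm sg = 1 -> 0 <= B r sg) -> 0 < eps ->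
     ((forall i, (1 <= i <= s)%N -> imex_scheme B A At eps dt fn F i) <->
      (forall i, (1 <= i <= s)%N -> forall x v,
         F i x v = type_CK_rhs B A At eps dt fn F i x v
           + dt * dt_CK At i * sl_shift A dt i 0 (epsQ B eps fn) x v))
     /\
     (hat_col At = 0 \/ (forall x v, Q_P B (fn x) v = 0) ->
      (forall i, (1 <= i <= s)%N -> imex_scheme B A At eps dt fn F i) <->
      (forall i, (1 <= i <= s)%N -> forall x v,
         F i x v = type_CK_rhs B A At eps dt fn F i x v))).
Proof.
split=> [uAt|hCK hc d B eps dt fn F _ _].
  exists (type_A_comb A At); split=> [i _|d B eps dt fn F _ _].
    exact: type_A_comb_admissible.
  by apply: forall_range_iff => i; exact: type_A_stage.
have CK : (forall i, (1 <= i <= s)%N -> imex_scheme B A At eps dt fn F i) <->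
    (forall i, (1 <= i <= s)%N -> forall x v,
       F i x v = type_CK_rhs B A At eps dt fn F i x v
         + dt * dt_CK At i * sl_shift A dt i 0 (epsQ B eps fn) x v).
  by apply: forall_range_iff => i; exact: type_CK_stage.
split=> // h0; rewrite CK.
(* A zero first column annihilates the weight [dt_CK]; the other alternative annihilates Q_P(f^n)
   itself. *)
have z i x v : dt * dt_CK At i * sl_shift A dt i 0 (epsQ B eps fn) x v = 0.
  case: h0 => [h0|h0]; first by rewrite dt_CK_hat_col0 // mulr0 mul0r.
  by rewrite /sl_shift /epsQ h0 !mulr0.
by split=> H i iS x v; rewrite H // z addr0.
Qed.
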